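(* Let $q=p^e$ with $p$ a prime and $e\ge1$, let $r\ge 2$ and $m=2r$. Let $D=\{x\in\mathbb{F}_{q^m}:\mathrm{Tr}_{q^r/q}(x^{q^r+1})=0\}$ and $$\overline{\mathcal{C}_D}=\{(\mathrm{Tr}_{q^m/q}(bx)+c)_{x\in D}: b\in\mathbb{F}_{q^m},\ c\in\mathbb{F}_q\}.$$ Then $\overline{\mathcal{C}_D}$ is a $[q^{r-1}(q^r-q+1),\ m+1,\ q^{r-1}(q^r-q^{r-1}-q+1)]$ linear code over $\mathbb{F}_q$ whose weight distribution is: weight $0$ with frequency $1$; weight $q^{r-1}(q^r-q^{r-1}-q+1)$ with frequency $q^{r-1}(2q^{r+1}-2q^r-q^2+3q-2)-q+1$; weight $q^{r-1}(q^r-q^{r-1}-q+2)$ with frequency $q^{r-1}(q-1)(q^{r+1}-q^r+q-1)$; weight $q^{2r-2}(q-1)$ with frequency $q^{r-1}(q^r-q+1)-1$; weight $q^{r-1}(q^r-q+1)$ with frequency $q-1$. Moreover, writing $n=q^{r-1}(q^r-q+1)$: if $q>2$, then $\overline{\mathcal{C}_D}^{\perp}$ has parameters $[n,n-m-1,3]$ and is at least almost optimal according to the sphere-packing bound; if $q=2$ and $r>2$, then $\overline{\mathcal{C}_D}^{\perp}$ has parameters $[n,n-m-1,4]$ and is optimal according to the sphere-packing bound.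
   Context: $\mathrm{Tr}_{q^k/q}$ denotes the trace map from $\mathbb{F}_{q^k}$ to $\mathbb{F}_q$. Coordinates are indexed by the elements of $D$ in a fixed order. An $[n,k,d]$ code is optimal if no $[n,k,d+1]$ code over the same field exists, and almost optimal if an optimal $[n,k,d+1]$ code exists; ''at least almost optimal according to the sphere-packing bound'' means the sphere-packing bound $q^k\le q^n/\sum_{i=0}^{\lfloor (d'-1)/2\rfloor}\binom{n}{i}(q-1)^i$ rules out an $[n,k,d+2]$ code (so the code is optimal or almost optimal), and ''optimal according to the sphere-packing bound'' means the bound rules out an $[n,k,d+1]$ code. *)

(* Defs.v *)
From HB Require Import structures.
From mathcomp Require Import all_boot all_order all_algebra all_field.
Set Implicit Arguments. Unset Strict Implicit. Unset Printing Implicit Defensive.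
Import Order.TTheory GRing.Theory.
Local Open Scope ring_scope.

(* Trace from F_{q^k} down to F_q, written as the sum of the Frobenius
   conjugates y, y^q, ..., y^(q^(k-1)) computed inside the ambient field L. *)
Definition trq (L : finFieldType) (q k : nat) (y : L) : L :=
  \sum_(i < k) y ^+ (q ^ i).

Definition Dset (L : finFieldType) (q r : nat) : {set L} :=
  [set x : L | trq q r (x ^+ (q ^ r).+1) == 0].

(* The augmented code  { (Tr_{q^m/q}(b x) + c)_{x in D} : b in L, c in F }.
   Coordinate i corresponds to the element enum_val i of D.  The values of
   Tr_{q^m/q} lie in the copy iota(F) of F_q inside L. *)
Definition codeD (F L : finFieldType) (iota : F -> L) (q m r : nat)
  : {set 'rV[F]_#|Dset L q r|} :=
  [set w : 'rV[F]_#|Dset L q r| | [exists b : L, exists c : F,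
     [forall i, iota (w 0 i) == trq q m (b * enum_val i) + iota c]]].

Definition wt (F : finFieldType) (n : nat) (v : 'rV[F]_n) : nat :=
  #|[set i | v 0 i != 0]|.

Definition is_linear (F : finFieldType) (n : nat) (C : {set 'rV[F]_n}) : Prop :=
  forall v, v \in <<enum C>>%VS -> v \in C.

Definition code_dim (F : finFieldType) (n : nat) (C : {set 'rV[F]_n}) : nat :=
  \dim <<enum C>>%VS.

(* d is the minimum distance (= minimum nonzero weight for linear codes) *)
Definition min_dist_is (F : finFieldType) (n : nat) (C : {set 'rV[F]_n}) (d : nat) : Prop :=
  (exists2 c, c \in C & (c != 0) && (wt c == d)) /\
  (forall c, c \in C -> c != 0 -> (d <= wt c)%N).

Definition code_params (F : finFieldType) (n : nat) (C : {set 'rV[F]_n}) (k d : nat) : Prop :=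
  [/\ is_linear C, code_dim C = k & min_dist_is C d].

Definition dual (F : finFieldType) (n : nat) (C : {set 'rV[F]_n}) : {set 'rV[F]_n} :=
  [set v : 'rV[F]_n | [forall c in C, v *m c^T == 0]].

(* The sphere-packing bound  q^k <= q^n / sum_{i=0}^{floor((d-1)/2)} C(n,i)(q-1)^i
   rules out an [n,k,d] code over F_q (cleared of denominators). *)
Definition spb_excludes (q n k d : nat) : Prop :=
  (q ^ n < q ^ k * \sum_(i < ((d - 1)./2).+1) 'C(n, i) * (q - 1) ^ i)%N.

(* weight distribution given as a list of (weight, frequency) pairs; the
   number of codewords of weight w is the sum of the frequencies listed with
   weight w (listed weights may coincide for small q). *)
Definition has_weight_distribution (F : finFieldType) (n : nat) (C : {set 'rV[F]_n})
  (dist : seq (int * int)) : Prop :=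
  forall w : int,
    (#|[set c in C | (wt c)%:Z == w]|)%:Z =
    \sum_(pa <- dist) (if pa.1 == w then pa.2 else 0).

(* Main.v *)
Require Import Defs.
From HB Require Import structures.
From mathcomp Require Import all_boot all_order all_algebra all_field.
From mathcomp Require Import zify ring.
Set Implicit Arguments. Unset Strict Implicit. Unset Printing Implicit Defensive.
Import Order.TTheory GRing.Theory Num.Theory.
Local Open Scope ring_scope.

(** [Q x = Tr_{q^r/q} (x^(q^r+1))] is a nondegenerate quadratic form over [F_q]
    with polar form [B x y = Tr_{q^m/q} (x^(q^r) y)], and [D] is its zero set;
    counting fibres of the norm and of the trace gives [#|D|].  A codeword is
    the restriction to [D] of an affine function [x |-> B b x + c], so its
    weight is read off the size of [{x in D | B b x = - c}].  For [c != 0] this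
    size does not depend on [c], because [D] is a cone.  If [b != 0] is
    singular, [Q] is affine and nonconstant on every line of direction [b]
    off [b^perp], which gives the size for [c != 0] and hence for [c = 0].
    If [b] is nonsingular, the first two moments over all [b] of the size for
    [c = 0] leave no room for variance, so it is constant.

    A word of the dual is an affine dependency between points of [D], and
    distinct points never have one of length two.  For [q > 2] three points of
    [D] on a line through [0] give weight 3; for [q = 2] all affine
    dependencies have even length, and a totally singular plane gives weight 4. *)

(** * Cardinalities as integer sums of indicators *)

Lemma card_pred_sum (I : finType) (A : {set I}) (P : pred I) :
  #|[set i in A | P i]|%:Z = \sum_(i in A) (P i)%:R.
Proof.
rewrite -natz -sum1_card natr_sum big_mkcond [RHS]big_mkcond /=.
by apply: eq_bigr => i _; rewrite inE; case: (i \in A) => //=; case: (P i).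
Qed.

Lemma card_predT_sum (I : finType) (P : pred I) :
  #|[set i | P i]|%:Z = \sum_i (P i)%:R.
Proof.
transitivity (#|[set i in setT | P i]|%:Z).
  by congr (#|pred_of_set _|%:Z); apply/setP => i; rewrite !inE.
by rewrite card_pred_sum; apply: eq_bigl => i; rewrite inE.
Qed.

(** * Counting along parallel lines *)

Section LineSections.
Variables (F L : finFieldType) (iota : {rmorphism F -> L}).

(** The map sending [(s, y)] to [y + iota s * a] is a bijection from [F * P] onto [A], because each
    line of direction [a] in [A] meets [P] exactly once. *)
Lemma card_line_section (a : L) (A P : {set L}) :
    (forall s x, x \in A -> x + iota s * a \in A) -> P \subset A ->
    (forall x, x \in A -> exists s, forall s', (x + iota s' * a \in P) = (s' == s)) ->
  #|A| = (#|F| * #|P|)%N.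
Proof.
move=> Acl sPA uniqP; pose g (u : F * L) := u.2 + iota u.1 * a.
have ->: A = g @: setX [set: F] P.
  apply/setP=> x; apply/idP/imsetP => [Ax | [[s y] /setXP[_ /= Py] ->]]; last first.
    exact/Acl/(subsetP sPA).
  have [s sP] := uniqP x Ax; exists (- s, x + iota s * a).
    by rewrite !inE sP eqxx.
  by rewrite /g /= rmorphN mulNr addrK.
rewrite card_in_imset ?cardsX ?cardsT // => -[s y] [s' y'] /setXP[_ /= Py].
case/setXP=> _ /= Py'; rewrite /g /= => eq_g.
have [t tP] := uniqP y (subsetP sPA y Py).
have t0 : t = 0 by apply/esym/eqP; rewrite -tP rmorph0 mul0r addr0.
have yE : y + iota (s - s') * a = y'.
  by rewrite rmorphB mulrBl addrA eq_g addrK.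
have /eqP : s - s' == t by rewrite -tP yE.
rewrite t0 => /eqP; rewrite subr_eq0 => /eqP ss'.
by move: yE; rewrite ss' subrr rmorph0 mul0r addr0 => ->.
Qed.

(** On each line of direction [a], [f] is affine with slope [f a], so it takes the value [t] exactly
    once. *)
Lemma card_linear_section (f : L -> F) (a : L) (A : {set L}) (t : F) :
    (forall s x y, f (iota s * x + y) = s * f x + f y) ->
    (forall s x, x \in A -> x + iota s * a \in A) -> f a != 0 ->
  #|A| = (#|F| * #|[set x in A | f x == t]|)%N.
Proof.
move=> flin Acl fa; apply: (card_line_section Acl).
  by apply/subsetP=> x; rewrite inE => /andP[].
move=> x Ax; exists ((t - f x) / f a) => s.
rewrite inE Acl //= addrC flin.
by apply/eqP/eqP => [<-|->]; [rewrite addrK mulfK | rewrite divfK // subrK].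
Qed.

End LineSections.

(** * Hyperplane sections of a nondegenerate quadric *)

Section Quadric.
Variables (F L : finFieldType) (iota : {rmorphism F -> L}).
Variables (Q : L -> F) (B : L -> L -> F).
Hypothesis QD : forall x y, Q (x + y) = Q x + Q y + B x y.
Hypothesis QZ : forall s x, Q (iota s * x) = s ^+ 2 * Q x.
Hypothesis Blin : forall x s y z, B x (iota s * y + z) = s * B x y + B x z.
Hypothesis Bnd : forall x, x != 0 -> exists y, B x y != 0.

Local Notation q := #|F|.
Definition quadric : {set L} := [set x | Q x == 0].
Definition quadric_section b t : {set L} := [set x in quadric | B b x == t].
Local Notation D := quadric.
Local Notation S := quadric_section.

Lemma polarC x y : B x y = B y x.
Proof.
by have := QD x y; rewrite addrC QD [Q y + Q x]addrC => /addrI.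
Qed.

Lemma polarZr x s y : B x (iota s * y) = s * B x y.
Proof.
have B0 : B x 0 = 0.
  have := Blin x 1 0 0; rewrite mul1r mulr0 addr0 => /eqP.
  by rewrite -subr_eq subrr eq_sym => /eqP.
by have := Blin x s y 0; rewrite B0 !addr0.
Qed.

Lemma polar0r x : B x 0 = 0.
Proof. by have := polarZr x 0 0; rewrite mulr0 mul0r. Qed.

(** Comparing [Q (x + x)] computed by scaling and by polarization gives this in every
    characteristic; in particular a singular vector is orthogonal to itself. *)
Lemma polar_diag x : B x x = Q x *+ 2.
Proof.
have := QZ 2 x; have -> : iota 2 * x = x + x.
  by rewrite rmorph_nat mulr_natl mulr2n.
rewrite QD => E; apply: (@addrI _ (Q x + Q x)); rewrite E.
by rewrite -!mulr2n -mulrnA -mulr_natl; ring.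
Qed.

Lemma quadric0 : 0 \in D.
Proof. by have := QZ 0 0; rewrite inE mulr0 expr0n mul0r => ->. Qed.

Lemma cardsD1_quadric : #|D :\ 0|%:Z = #|D|%:Z - 1.
Proof. by rewrite (cardsD1 0 D) quadric0 PoszD addrC addKr. Qed.

Lemma quadricZ s x : x \in D -> iota s * x \in D.
Proof. by rewrite !inE QZ => /eqP->; rewrite mulr0. Qed.

Lemma card_hyperplane b t :
  b != 0 -> #|L| = (q * #|[set x | B b x == t]|)%N.
Proof.
case/Bnd=> a Ba; rewrite -cardsT.
rewrite (card_linear_section (iota := iota) (f := B b) (a := a) t) //.
  by congr (_ * #|pred_of_set _|)%N; apply/setP=> x; rewrite !inE.
by move=> *; rewrite inE.
Qed.

(* Along a line in a singular direction [b] off the hyperplane [b^perp],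
   [Q] is an affine function, hence vanishes exactly once. *)
Lemma card_singular_section b t :
  b \in D -> b != 0 -> t != 0 -> #|L| = (q ^ 2 * #|S b t|)%N.
Proof.
rewrite inE => /eqP Qb b0 t0; rewrite (card_hyperplane t b0) -mulnn -mulnA.
congr (_ * _)%N; have Bbb : B b b = 0 by rewrite polar_diag Qb mul0rn.
apply: (card_line_section (iota := iota) (a := b)).
- by move=> s x; rewrite !inE addrC Blin Bbb mulr0 add0r.
- by apply/subsetP=> x; rewrite !inE => /andP[].
move=> x; rewrite inE => /eqP Bx; exists (- Q x / t) => s.
rewrite !inE {2}addrC Blin Bbb mulr0 add0r Bx eqxx andbT.
rewrite QD QZ Qb mulr0 addr0 polarZr polarC Bx addrC addr_eq0.
by apply/eqP/eqP => [<-|->]; rewrite ?mulfK ?divfK.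
Qed.

Lemma card_sectionZ b s t : s != 0 -> #|S b (s * t)| = #|S b t|.
Proof.
move=> s0; have is0 : iota s != 0 by rewrite fmorph_eq0.
rewrite -(card_imset (S b t) (mulfI is0)); apply: eq_card => x.
apply/idP/imsetP=> [|[y + ->]]; last first.
  by rewrite !inE QZ polarZr => /andP[/eqP-> /eqP->]; rewrite mulr0 !eqxx.
rewrite !inE => /andP[Qx /eqP Bx]; exists (iota s^-1 * x).
  by rewrite !inE QZ (eqP Qx) mulr0 eqxx polarZr Bx mulKf /=.
by rewrite mulrA -rmorphM divff // rmorph1 mul1r.
Qed.

Lemma card_sections b t : t != 0 -> #|D| = (#|S b 0%R| + q.-1 * #|S b t|)%N.
Proof.
move=> t0; rewrite -sum1_card (partition_big (B b) predT) //= (bigD1 0) //=.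
have cardS u : (\sum_(x in D | B b x == u) 1 = #|S b u|)%N.
  by rewrite -sum1_card; apply: eq_bigl => x; rewrite [RHS]inE.
rewrite cardS (eq_bigr (fun=> #|S b t|)) => [|u u0].
  by rewrite sum_nat_const cardC1.
by rewrite cardS -(card_sectionZ b t (s := u / t)) ?divfK // mulf_neq0 ?invr_eq0.
Qed.

(** Independent vectors define independent functionals, so [B y] is nonzero somewhere on the
    hyperplane orthogonal to [x] and cuts it by one more factor [q]. *)
Lemma card_codim2 x y : x != 0 -> (forall s, y != iota s * x) ->
  #|L| = (q ^ 2 * #|[set b | (B x b == 0%R) && (B y b == 0%R)]|)%N.
Proof.
move=> x0 yNx; rewrite (card_hyperplane 0 x0) -mulnn -mulnA; congr (_ * _)%N.
set H := [set _ | _]; have [a Ha Bya] : exists2 a, a \in H & B y a != 0.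
  apply/exists_inP; have [//|/exists_inPn yH] := boolP [exists a in H, B y a != 0].
  have [c Bxc] := Bnd x0; exfalso.
  (* If [B y] vanished on the hyperplane, it would be [s] times [B x], and [y - iota s * x] would
     lie in the radical. *)
  pose s := B y c / B x c; have [/eqP|/Bnd[d]] := eqVneq (iota (- s) * x + y) 0.
    rewrite rmorphN mulNr addrC subr_eq0 => /eqP yE.
    by have := yNx s; rewrite yE eqxx.
  rewrite polarC Blin ![B d _]polarC.
  have /yH : iota (- (B x d / B x c)) * c + d \in H.
    by rewrite inE Blin mulNr divfK // addNr.
  rewrite negbK Blin => /eqP E /negP[]; apply/eqP; rewrite -{}E /s.
  by field.
rewrite (card_linear_section (iota := iota) (f := B y) (a := a) 0) //.
  by congr (_ * #|pred_of_set _|)%N; apply/setP=> b; rewrite !inE.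
by move=> s b; move: Ha; rewrite !inE addrC Blin => /eqP-> /eqP->; rewrite mulr0 addr0.
Qed.

(** * Section sizes, to be used with [X = q ^ (r - 1)] *)

Section Sizes.
Variable X : nat.
Hypothesis cardL : #|L| = (q ^ 2 * X ^ 2)%N.
Hypothesis cardD : #|D|%:Z = q%:Z * X%:Z ^+ 2 - (q%:Z - 1) * X%:Z.

Let q_gt0 : (0 < q)%N. Proof. by apply/card_gt0P; exists 0. Qed.

Lemma card_singular_section_neq0 b t :
  b \in D -> b != 0 -> t != 0 -> #|S b t| = (X ^ 2)%N.
Proof.
move=> Db b0 t0; have := card_singular_section Db b0 t0; rewrite cardL.
by move/eqP; rewrite eqn_pmul2l ?expn_gt0 ?q_gt0 // => /eqP.
Qed.

Lemma card_singular_section0 b :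
  b \in D -> b != 0 -> #|S b 0|%:Z = X%:Z ^+ 2 - (q%:Z - 1) * X%:Z.
Proof.
move=> Db b0; have := card_sections b (oner_neq0 F).
rewrite (card_singular_section_neq0 Db b0 (oner_neq0 F)) => E.
by move: cardD; rewrite E -[in q%:Z](prednK q_gt0); lia.
Qed.

Let incident b x : int := (B b x == 0)%:R.

Let card_sectionE b : #|S b 0|%:Z = \sum_(x in D) incident b x.
Proof. exact: card_pred_sum. Qed.

Let sum_incident x :
  \sum_b incident b x = if x == 0 then q%:Z ^+ 2 * X%:Z ^+ 2 else q%:Z * X%:Z ^+ 2.
Proof.
case: eqP => [->|/eqP x0].
  rewrite (eq_bigr (fun=> 1)) => [|b _]; last by rewrite /incident polar0r eqxx.
  by rewrite sumr_const natz cardL PoszM -!natz !natrX.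
rewrite -card_predT_sum (eq_card (B := [set b | B x b == 0])) => [|b]; last first.
  by rewrite !inE polarC.
have := card_hyperplane 0 x0; rewrite cardL -mulnn -mulnA => /eqP.
by rewrite eqn_pmul2l // => /eqP <-; rewrite PoszM -!natz natrX.
Qed.

Let sum_incident2 x y : x != 0 -> (forall s, y != iota s * x) ->
  \sum_b incident b x * incident b y = X%:Z ^+ 2.
Proof.
move=> x0 yNx; rewrite (eq_bigr (fun b => ((B b x == 0) && (B b y == 0))%:R)).
  rewrite -card_predT_sum.
  rewrite (eq_card (B := [set b | (B x b == 0) && (B y b == 0)])) => [|b].
    have /eqP := card_codim2 x0 yNx.
    by rewrite cardL eqn_pmul2l ?expn_gt0 ?q_gt0 // => /eqP <-; rewrite -!natz natrX.
  by rewrite !inE ![B _ b]polarC.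
by move=> b _; rewrite -natrM mulnb.
Qed.

Let sum_sections : \sum_b #|S b 0|%:Z
  = q%:Z ^+ 2 * X%:Z ^+ 2 + (#|D|%:Z - 1) * (q%:Z * X%:Z ^+ 2).
Proof.
under eq_bigr do rewrite card_sectionE.
rewrite exchange_big (big_setD1 0) ?quadric0 //= sum_incident eqxx; congr (_ + _).
rewrite (eq_bigr (fun=> q%:Z * X%:Z ^+ 2)) => [|x]; last first.
  by rewrite in_setD1 sum_incident => /andP[/negbTE ->].
by rewrite sumr_const -mulr_natl natz cardsD1_quadric.
Qed.

(** The [q] multiples [y] of [x] add no condition beyond [B b x = 0], while every other point of [D]
    is independent of [x] and adds a second condition. *)
Let sum_incident_line x : x \in D -> x != 0 ->
  \sum_(y in D) \sum_b incident b x * incident b y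
  = q%:Z * (q%:Z * X%:Z ^+ 2) + (#|D|%:Z - q%:Z) * X%:Z ^+ 2.
Proof.
move=> Dx x0; pose l := [set iota s * x | s : F].
have cardl : #|l| = q.
  by rewrite card_imset ?cardsT // => s t /(mulIf x0)/fmorph_inj.
have lD : l \subset D by apply/subsetP=> _ /imsetP[s _ ->]; exact: quadricZ.
rewrite (big_setID l) /= (setIidPr lD); congr (_ + _).
  rewrite (eq_bigr (fun=> q%:Z * X%:Z ^+ 2)) => [|_ /imsetP[s _ ->]].
    by rewrite sumr_const cardl -mulr_natl natz.
  transitivity (\sum_b incident b x); last by rewrite sum_incident (negbTE x0).
  apply: eq_bigr => b _; rewrite /incident polarZr.
  by case: eqP => [->|_]; rewrite ?mul0r // mulr0 eqxx mul1r.
rewrite (eq_bigr (fun=> X%:Z ^+ 2)) => [|y].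
  rewrite sumr_const -mulr_natl natz cardsD (setIidPr lD) cardl subzn //.
  by rewrite -cardl subset_leq_card.
rewrite inE => /andP[yl _]; apply: sum_incident2 => // s.
by apply: contra yl => /eqP ->; apply: imset_f.
Qed.

(** The square counts ordered pairs of points of [D] orthogonal to [b]. Pairs starting with [0] give
    back the first moment; the others are grouped by their first member. *)
Let sum_sections_sqr : \sum_b #|S b 0|%:Z ^+ 2
  = \sum_b #|S b 0|%:Z
    + (#|D|%:Z - 1) * (q%:Z * (q%:Z * X%:Z ^+ 2) + (#|D|%:Z - q%:Z) * X%:Z ^+ 2).
Proof.
have -> : \sum_b #|S b 0|%:Z ^+ 2
    = \sum_(x in D) \sum_(y in D) \sum_b incident b x * incident b y.
  under [RHS]eq_bigr do rewrite exchange_big.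
  rewrite [RHS]exchange_big; apply: eq_bigr => b _.
  by rewrite card_sectionE expr2 big_distrlr.
rewrite (big_setD1 0) ?quadric0 //=; congr (_ + _).
  rewrite exchange_big; apply: eq_bigr => b _ /=.
  rewrite card_sectionE; apply: eq_bigr => y _.
  by rewrite /incident polar0r eqxx mul1r.
under eq_bigr => x /setD1P[x0 Dx] do rewrite (sum_incident_line Dx x0).
by rewrite sumr_const -mulr_natl natz cardsD1_quadric.
Qed.

(* The first two moments of [#|S b 0|] over all [b], minus the known
   contributions of the singular [b], show that the variance of [#|S b 0|]
   over the nonsingular [b] vanishes. *)
Lemma card_nonsingular_section0 b : b \notin D -> #|S b 0| = (X ^ 2)%N.
Proof.
have V : \sum_c (#|S c 0|%:Z - X%:Z ^+ 2) ^+ 2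
    = \sum_c #|S c 0|%:Z ^+ 2 - 2 * X%:Z ^+ 2 * (\sum_c #|S c 0|%:Z)
      + q%:Z ^+ 2 * X%:Z ^+ 2 * X%:Z ^+ 4.
  have -> : q%:Z ^+ 2 * X%:Z ^+ 2 * X%:Z ^+ 4 = \sum_(c : L) X%:Z ^+ 4.
    by rewrite sumr_const cardL -mulr_natl natz PoszM -!natz !natrX.
  rewrite mulr_sumr -sumrB -big_split; apply: eq_bigr => c _ /=; ring.
(* The vector [0] is singular, but its section is all of [D], so it is split off from the other
   singular vectors. *)
have SD0 : S 0 0 = D.
  by apply/setP=> x; rewrite inE polarC polar0r eqxx andbT.
have V0 : \sum_(c in ~: D) (#|S c 0|%:Z - X%:Z ^+ 2) ^+ 2 = 0.
  have V1 : \sum_(c in D :\ 0) (#|S c 0|%:Z - X%:Z ^+ 2) ^+ 2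
      = (#|D|%:Z - 1) * ((q%:Z - 1) * X%:Z) ^+ 2.
    under eq_bigr => c /setD1P[c0 Dc] do rewrite (card_singular_section0 Dc c0).
    by rewrite sumr_const -mulr_natl natz cardsD1_quadric; ring.
  (* Once the singular vectors are removed, the remaining polynomial in [q] and [X] is identically
     zero. *)
  move: V; rewrite (bigID (mem D)) /= (big_setD1 0) ?quadric0 //= SD0 V1.
  rewrite sum_sections_sqr sum_sections cardD => E.
  under eq_bigl do rewrite inE.
  by move/(canRL (addKr _)): E => ->; ring.
rewrite -in_setC => Db.
have /eqP := psumr_eq0P (fun _ _ => sqr_ge0 _) V0 Db.
by rewrite sqrf_eq0 subr_eq0 -natz -[X%:Z]natz -natrX !natz => /eqP[].
Qed.

Lemma card_nonsingular_section_neq0 b t : b \notin D -> t != 0 ->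
  #|S b t|%:Z = X%:Z ^+ 2 - X%:Z.
Proof.
move=> Db t0; have := card_sections b t0.
rewrite card_nonsingular_section0 // => E.
have q1 : (q.-1)%:Z != 0.
  by rewrite -lt0n -ltnS (prednK q_gt0) finNzRing_gt1.
apply: (mulfI q1); move: cardD; rewrite E -[in q%:Z](prednK q_gt0); lia.
Qed.

End Sizes.
End Quadric.

(** * Fibre counting and root bounds *)

Section CardFibers.
Variables (I J : finType) (f : I -> J) (S : {set I}) (T : {set J}) (c : nat).
Hypothesis fST : forall x, x \in S -> f x \in T.
Local Notation fiber y := [set x in S | f x == y].

Lemma card_fibers : #|S| = (\sum_(y in T) #|fiber y|)%N.
Proof.
rewrite -sum1_card (partition_big f (mem T)) //=.
apply: eq_bigr => y _; rewrite -sum1_card; apply: eq_bigl => x.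
by rewrite [RHS]inE.
Qed.

(** If the total reaches the sum of the upper bounds, no fibre can fall short. This turns root-count
    bounds into exact fibre sizes. *)
Lemma card_fiber_eq y : (forall z, z \in T -> #|fiber z| <= c)%N ->
  (#|T| * c <= #|S|)%N -> y \in T -> #|fiber y| = c.
Proof.
move=> le_c; rewrite card_fibers -sum_nat_const => le_sum Ty.
have [le_S eqS] := leqif_sum (fun z Tz => leqif_eq (le_c z Tz)).
by move: eqS; rewrite eqn_leq le_S le_sum => /esym/forall_inP/(_ y Ty)/eqP.
Qed.

End CardFibers.

Lemma card_roots_lt (R : finFieldType) (p : {poly R}) :
  p != 0 -> (#|[set x | root p x]| < size p)%N.
Proof.
move=> p0; rewrite cardE; apply: max_poly_roots => //; last exact: enum_uniq.
by apply/allP=> x; rewrite mem_enum inE.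
Qed.

(** * Frobenius powers and the trace *)

Section FieldTrace.
Variables (L : finFieldType) (q : nat).
Hypothesis qL : [pchar L].-nat q.
Hypothesis q_gt1 : (1 < q)%N.

Let q_gt0 : (0 < q)%N. Proof. exact: ltnW. Qed.

Lemma frobeniusD i (x y : L) : (x + y) ^+ (q ^ i) = x ^+ (q ^ i) + y ^+ (q ^ i).
Proof. by rewrite exprDn_pchar // pnatX qL. Qed.

Lemma frobenius_sum (I : finType) (f : I -> L) :
  (\sum_i f i) ^+ q = \sum_i f i ^+ q.
Proof.
elim/big_rec2: _ => [|i x y _ <-]; first by rewrite expr0n gtn_eqF.
by rewrite -[in LHS](expn1 q) frobeniusD expn1.
Qed.

Lemma trqD k (x y : L) : trq q k (x + y) = trq q k x + trq q k y.
Proof. by rewrite /trq -big_split; apply: eq_bigr => i _; rewrite frobeniusD. Qed.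

Lemma trq0 k : trq q k (0 : L) = 0.
Proof. by apply: (addrI (trq q k 0)); rewrite -trqD !addr0. Qed.

Lemma expr_frobenius_fixed (s : L) i : s ^+ q = s -> s ^+ (q ^ i) = s.
Proof. by move=> sq; elim: i => [|i IH]; rewrite ?expn0 // expnS exprM sq. Qed.

Lemma trqZ k (s x : L) : s ^+ q = s -> trq q k (s * x) = s * trq q k x.
Proof.
move=> sq; rewrite /trq mulr_sumr; apply: eq_bigr => i _.
by rewrite exprMn (expr_frobenius_fixed i sq).
Qed.

Lemma trq_frobenius k (y : L) : trq q k (y ^+ q) = trq q k y ^+ q.
Proof.
by rewrite /trq frobenius_sum; apply: eq_bigr => i _; rewrite -!exprM mulnC.
Qed.

Lemma trq_fixed k (y : L) : y ^+ (q ^ k) = y -> trq q k (y ^+ q) = trq q k y.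
Proof.
case: k => [|k] yq; first by rewrite /trq !big_ord0.
rewrite /trq big_ord_recr [RHS]big_ord_recl /= expn0 expr1 -exprM -expnS yq addrC.
by congr (_ + _); apply: eq_bigr => i _; rewrite -exprM -expnS.
Qed.

Lemma trq_in_base k (y : L) : y ^+ (q ^ k) = y -> trq q k y ^+ q = trq q k y.
Proof. by move=> yq; rewrite -trq_frobenius trq_fixed. Qed.

(** Transitivity of the trace: the upper half of the conjugates is the lower half raised to the
    power [q ^ k]. *)
Lemma trq_double k (y : L) : trq q (2 * k) y = trq q k (y + y ^+ (q ^ k)).
Proof.
rewrite mul2n -addnn trqD /trq big_split_ord /=; congr (_ + _).
by apply: eq_bigr => i _; rewrite -exprM expnD.
Qed.

(** The kernel consists of roots of a linearized polynomial of degree [q ^ (k - 1)]. *)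
Lemma card_trq_ker k : (0 < k)%N -> (#|[set x : L | trq q k x == 0%R]| <= q ^ k.-1)%N.
Proof.
case: k => // k _; pose P : {poly L} := \sum_(i < k.+1) 'X^(q ^ i).
have sP : (size P <= (q ^ k).+1)%N.
  apply: (leq_trans (size_sum _ _ _)); apply/bigmax_leqP => i _.
  by rewrite size_polyXn ltnS leq_exp2l // -ltnS.
have P0 : P != 0.
  (* The coefficient of ['X] is 1, since only the index 0 gives the exponent 1. *)
  apply/eqP => /(congr1 (fun p : {poly L} => p`_1)); rewrite coef0 coef_sum.
  rewrite big_ord_recl big1 => [|i _]; rewrite coefXn /=.
    by rewrite addr0 => /eqP; rewrite oner_eq0.
  by rewrite -[X in X == _]/(1%N) -(expn0 q) eqn_exp2l.
rewrite -ltnS; apply: leq_trans sP; apply: leq_ltn_trans (card_roots_lt P0).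
rewrite subset_leq_card //; apply/subsetP => x; rewrite !inE => /eqP Tx.
rewrite rootE horner_sum -[X in _ == X]Tx; apply/eqP/eq_bigr => i _.
by rewrite hornerXn.
Qed.

Lemma card_fixed_le k : (0 < k)%N -> (#|[set x : L | x ^+ (q ^ k) == x]| <= q ^ k)%N.
Proof.
move=> k0; have qk1 : (1 < q ^ k)%N by rewrite -{1}(expn0 q) ltn_exp2l.
have sz : size ('X^(q ^ k) - 'X : {poly L}) = (q ^ k).+1.
  by rewrite size_polyDl size_polyXn // size_polyN size_polyX ltnS.
have P0 : 'X^(q ^ k) - 'X != 0 :> {poly L} by rewrite -size_poly_eq0 sz.
rewrite -ltnS -sz; apply: leq_ltn_trans (card_roots_lt P0).
rewrite subset_leq_card //; apply/subsetP => x; rewrite !inE => /eqP xq.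
by rewrite rootE hornerD hornerN hornerXn hornerX xq subrr.
Qed.

End FieldTrace.

(** * The quadratic form obtained from norm and trace *)

Section TraceForm.
Variables (F L : finFieldType) (iota : {rmorphism F -> L}) (q r : nat).
Hypothesis qL : [pchar L].-nat q.
Hypothesis q_gt1 : (1 < q)%N.
Hypothesis r_gt0 : (0 < r)%N.
Hypothesis cardF : #|F| = q.
Hypothesis cardL : #|L| = (q ^ (2 * r))%N.

Let q_gt0 : (0 < q)%N. Proof. exact: ltnW. Qed.

Lemma expr_frobenius2r (x : L) : x ^+ (q ^ (2 * r)) = x.
Proof. by rewrite -cardL expf_card. Qed.

Lemma expr_frobenius_rr (x : L) : (x ^+ (q ^ r)) ^+ (q ^ r) = x.
Proof. by rewrite -exprM -expnD addnn -mul2n expr_frobenius2r. Qed.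

Lemma norm_fixed (x : L) : (x ^+ (q ^ r).+1) ^+ (q ^ r) = x ^+ (q ^ r).+1.
Proof. by rewrite exprS exprMn expr_frobenius_rr mulrC. Qed.

(** The intermediate field of order [q ^ r]. Root counting gives only an upper bound on its size;
    equality comes from the norm, in [card_fixed]. *)
Let E := [set y : L | y ^+ (q ^ r) == y].

Let E_fixed y : y \in E -> y ^+ (q ^ r) = y.
Proof. by rewrite inE => /eqP. Qed.

Let E0 : 0 \in E. Proof. by rewrite inE expr0n expn_eq0 gtn_eqF. Qed.

Let card_E_le : (#|E :\ 0%R| <= q ^ r - 1)%N.
Proof.
have := card_fixed_le L q_gt1 r_gt0.
by rewrite -/E (cardsD1 0 E) E0 leq_subRL ?expn_gt0 ?q_gt0.
Qed.

Let norm_E (x : L) : x \in [set~ 0] -> x ^+ (q ^ r).+1 \in E :\ 0.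
Proof. by rewrite !inE => x0; rewrite expf_eq0 norm_fixed eqxx andbT. Qed.

Let card_units : #|[set~ 0%R : L]| = ((q ^ r - 1) * (q ^ r).+1)%N.
Proof.
rewrite cardsC1 cardL mul2n -addnn expnD; have : (0 < q ^ r)%N by rewrite expn_gt0 q_gt0.
by case: (q ^ r)%N => // k _; lia.
Qed.

(** The [(q ^ r - 1) * (q ^ r + 1)] units are sent to at most [q ^ r - 1] values, and each fibre has
    at most [q ^ r + 1] elements as a set of roots. Both bounds must therefore be attained. *)
Lemma card_norm_fiber (y : L) : y ^+ (q ^ r) = y -> y != 0 ->
  #|[set x in [set~ 0%R] | x ^+ (q ^ r).+1 == y]| = (q ^ r).+1.
Proof.
move=> yq y0; apply: (@card_fiber_eq _ _ _ _ (E :\ 0)).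
- exact: norm_E.
- move=> z _; have sz : size ('X^((q ^ r).+1) - z%:P : {poly L}) = (q ^ r).+2.
    by rewrite size_XnsubC.
  have P0 : 'X^((q ^ r).+1) - z%:P != 0 :> {poly L} by rewrite -size_poly_eq0 sz.
  rewrite -ltnS -sz; apply: leq_ltn_trans (card_roots_lt P0).
  rewrite subset_leq_card //; apply/subsetP => x; rewrite !inE => /andP[_ /eqP xz].
  by rewrite rootE hornerD hornerN hornerXn hornerC xz subrr.
- by rewrite card_units leq_mul2r card_E_le orbT.
- by rewrite !inE y0 yq /=.
Qed.

(** Dividing the number of units by the common size of the norm fibres gives the number of nonzero
    elements of [E]. *)
Lemma card_fixed : #|[set y : L | y ^+ (q ^ r) == y]| = (q ^ r)%N.
Proof.
have := card_fibers norm_E; rewrite card_units (eq_bigr (fun=> (q ^ r).+1)).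
  rewrite sum_nat_const => /eqP; rewrite eqn_pmul2r // => /eqP eqE.
  by rewrite -/E (cardsD1 0 E) E0 -eqE subnKC // expn_gt0 q_gt0.
by move=> y /setD1P[y0 Ey]; rewrite card_norm_fiber ?E_fixed.
Qed.

Lemma base_expr s : iota s ^+ q = iota s.
Proof. by rewrite -rmorphXn -cardF expf_card. Qed.

(** The image of [iota] already supplies [q] roots of ['X^q - 'X], which has no more. *)
Lemma base_fieldP (y : L) : y ^+ q = y -> exists s, iota s = y.
Proof.
have -> : (y ^+ q = y) <-> y \in [set x | x ^+ (q ^ 1) == x].
  by rewrite inE; split=> [->|/eqP].
have /eqP <- : [set iota s | s : F] == [set x | x ^+ (q ^ 1) == x].
  rewrite eqEcard card_imset; last exact: fmorph_inj.
  rewrite cardF (leq_trans (card_fixed_le L q_gt1 _)) // andbT.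
  by apply/subsetP=> _ /imsetP[s _ ->]; rewrite inE base_expr.
by case/imsetP=> s _ ->; exists s.
Qed.

(** The bound on the kernel is below [q ^ r], so some [a] in [E] has nonzero trace. Each line of
    direction [a] in [E] then meets the kernel exactly once. *)
Lemma card_trace_kernel :
  #|[set y in [set y : L | y ^+ (q ^ r) == y] | trq q r y == 0%R]| = (q ^ (r - 1))%N.
Proof.
have [a Ea Ta] : exists2 a, a \in E & trq q r a != 0.
  apply/exists_inP; have [//|/exists_inPn TE] := boolP [exists a in E, trq q r a != 0].
  suff : (q ^ r <= q ^ r.-1)%N by rewrite leq_exp2l // -ltnS prednK // ltnn.
  rewrite -card_fixed; apply: leq_trans (card_trq_ker L q_gt1 r_gt0).
  apply/subset_leq_card/subsetP => y /TE; rewrite negbK => Ty.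
  by rewrite inE.
have E_fix s : iota s ^+ (q ^ r) = iota s.
  by apply: expr_frobenius_fixed; apply: base_expr.
have Ecl s x : x \in E -> x + iota s * a \in E.
  by move=> /E_fixed xq; rewrite inE frobeniusD // exprMn E_fix (E_fixed Ea) xq.
set K := [set y in _ | _].
suff: #|E| = (#|F| * #|K|)%N.
  rewrite card_fixed cardF -[in LHS](prednK r_gt0) expnS subn1 => /eqP.
  by rewrite eqn_pmul2l // => /eqP.
apply: (card_line_section Ecl).
  by apply/subsetP => y; rewrite inE => /andP[].
move=> x Ex; have [s sE] : exists s, iota s = - trq q r x / trq q r a.
  have [s sE] := base_fieldP (trq_in_base qL q_gt1 (E_fixed Ex)).
  have [t tE] := base_fieldP (trq_in_base qL q_gt1 (E_fixed Ea)).
  by exists (- s / t); rewrite rmorphM rmorphN fmorphV sE tE.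
exists s => t; rewrite inE Ecl //= trqD // trqZ ?base_expr // addrC addr_eq0.
rewrite -(inj_eq (fmorph_inj iota)) sE.
by apply/eqP/eqP => [<-|->]; rewrite ?mulfK ?divfK.
Qed.

(** Each nonzero element of the trace kernel is the norm of [q ^ r + 1] elements. With
    [X = q ^ (r - 1)] this makes [#|D| - 1] equal to [(X - 1) * (q * X + 1)]. *)
Lemma card_Dset : #|Dset L q r|%:Z
  = q%:Z * (q ^ (r - 1))%:Z ^+ 2 - (q%:Z - 1) * (q ^ (r - 1))%:Z.
Proof.
pose K := [set y in E | trq q r y == 0].
have K0 : 0 \in K by rewrite inE E0 trq0 /=.
have D0 : 0 \in Dset L q r by rewrite inE expr0n trq0.
have DK (x : L) : x \in Dset L q r :\ 0 -> x ^+ (q ^ r).+1 \in K :\ 0.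
  by rewrite !inE expf_eq0 norm_fixed eqxx.
have := card_fibers DK; rewrite (eq_bigr (fun=> (q ^ r).+1)) => [|y].
  have := card_trace_kernel; rewrite -/E -/K (cardsD1 0 K) (cardsD1 0 (Dset L q r)) K0 D0.
  rewrite sum_nat_const => KE ->.
  have -> : (q ^ r = q * q ^ (r - 1))%N by rewrite -expnS subn1 prednK.
  rewrite -KE !add1n; move: #|K :\ 0| => k.
  by rewrite -!natz !(natrM, mulrS); ring.
rewrite !inE => /and3P[y0 /eqP Ey Ty]; rewrite -[RHS](card_norm_fiber Ey y0).
apply: eq_card => x; rewrite !inE -!andbA; case: eqP => //= _.
by case: (x ^+ _ =P y) => [->|_]; rewrite ?Ty ?andbF.
Qed.

(** Inverse of [iota] on its image. The default 0 is never met below: the traces to which it is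
    applied are fixed by the [q]-th power. *)
Definition base_val (y : L) : F := odflt 0 [pick s | iota s == y].

Lemma base_valK y : y ^+ q = y -> iota (base_val y) = y.
Proof.
move/base_fieldP=> [s sE]; rewrite /base_val; case: pickP => [t /eqP //|/(_ s)].
by rewrite sE eqxx.
Qed.

Definition trace (x : L) : F := base_val (trq q (2 * r) x).
Definition quadf (x : L) : F := base_val (trq q r (x ^+ (q ^ r).+1)).
Definition polar (x y : L) : F := trace (x ^+ (q ^ r) * y).

Lemma iota_trace x : iota (trace x) = trq q (2 * r) x.
Proof. by apply/base_valK/trq_in_base => //; apply: expr_frobenius2r. Qed.

Lemma iota_quadf x : iota (quadf x) = trq q r (x ^+ (q ^ r).+1).
Proof. by apply/base_valK/trq_in_base => //; apply: norm_fixed. Qed.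

Lemma traceZD s x y : trace (iota s * x + y) = s * trace x + trace y.
Proof.
apply: (fmorph_inj iota); rewrite rmorphD rmorphM !iota_trace trqD // trqZ //.
exact: base_expr.
Qed.

Lemma traceZ s x : trace (iota s * x) = s * trace x.
Proof.
by apply: (fmorph_inj iota); rewrite rmorphM !iota_trace trqZ // base_expr.
Qed.

(** Since [b] is invertible, the trace would otherwise vanish on all of [L], which exceeds the
    kernel bound. *)
Lemma trace_nondegenerate b : b != 0 -> exists x, trace (b * x) != 0.
Proof.
move=> b0; apply/existsP; have [//|/existsPn T0] := boolP [exists x, trace (b * x) != 0].
have r2 : (0 < 2 * r)%N by rewrite muln_gt0.
have := card_trq_ker L q_gt1 r2; rewrite leqNgt => /negP[].
apply: (@leq_trans #|[set: L]|).
  by rewrite cardsT cardL ltn_exp2l // prednK.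
apply/subset_leq_card/subsetP => x _; rewrite inE -iota_trace fmorph_eq0.
by have := T0 (b^-1 * x); rewrite negbK mulVKf.
Qed.

(** The cross terms of the norm of [x + y] are [z + z ^+ (q ^ r)] with [z = x ^+ (q ^ r) * y], and
    [trq_double] collects them into the full trace of [z]. *)
Lemma quadfD x y : quadf (x + y) = quadf x + quadf y + polar x y.
Proof.
apply: (fmorph_inj iota); rewrite !rmorphD iota_trace !iota_quadf trq_double //.
rewrite -!trqD //; congr (trq _ _ _).
by rewrite exprMn expr_frobenius_rr !exprSr frobeniusD //; ring.
Qed.

Lemma quadfZ s x : quadf (iota s * x) = s ^+ 2 * quadf x.
Proof.
apply: (fmorph_inj iota); rewrite rmorphM rmorphXn !iota_quadf exprMn exprS.
rewrite expr_frobenius_fixed ?base_expr // -expr2 -trqZ // -rmorphXn.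
exact: base_expr.
Qed.

Lemma polarZD x s y z : polar x (iota s * y + z) = s * polar x y + polar x z.
Proof. by rewrite /polar mulrDr mulrCA traceZD. Qed.

Lemma polar_nondegenerate x : x != 0 -> exists y, polar x y != 0.
Proof. by move=> x0; apply: trace_nondegenerate; rewrite expf_eq0 negb_and x0 orbT. Qed.

Lemma quadric_quadf : quadric quadf = Dset L q r.
Proof. by apply/setP=> x; rewrite !inE -iota_quadf fmorph_eq0. Qed.

Let X := (q ^ (r - 1))%N.

Let cardL' : #|L| = (#|F| ^ 2 * X ^ 2)%N.
Proof. by rewrite cardL cardF /X -!expnM -expnD; congr (_ ^ _)%N; lia. Qed.

Let cardD' : #|quadric quadf|%:Z = #|F|%:Z * X%:Z ^+ 2 - (#|F|%:Z - 1) * X%:Z.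
Proof. by rewrite quadric_quadf card_Dset cardF. Qed.

(** Conjugate elements have the same norm. Hence singularity can be tested on [b] although the
    functional [tr (b x)] is represented by [b ^+ (q ^ r)]. *)
Lemma Dset_frobenius x : (x ^+ (q ^ r) \in Dset L q r) = (x \in Dset L q r).
Proof. by rewrite !inE -!exprM mulnC exprM norm_fixed. Qed.

Definition zeros b c : {set L} := [set x in Dset L q r | trace (b * x) + c == 0].

Let zerosE b c : zeros b c = quadric_section quadf polar (b ^+ (q ^ r)) (- c).
Proof.
apply/setP=> x; rewrite !inE -iota_quadf fmorph_eq0.
by rewrite /polar expr_frobenius_rr addr_eq0.
Qed.

Lemma card_zeros b c : #|zeros b c|%:Z =
  if b == 0 then (if c == 0 then #|Dset L q r|%:Z else 0)
  else if b \in Dset L q r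
  then (if c == 0 then X%:Z ^+ 2 - (q%:Z - 1) * X%:Z else X%:Z ^+ 2)
  else (if c == 0 then X%:Z ^+ 2 else X%:Z ^+ 2 - X%:Z).
Proof.
have [->|b0] := eqVneq b 0.
  have zE x : x \in zeros 0 c = (x \in Dset L q r) && (c == 0).
    rewrite inE mul0r; have := traceZ 0 0; rewrite mulr0 mul0r => ->.
    by rewrite add0r.
  case: eqP zE => [_|_] zE; first by congr _%:Z; apply: eq_card => x; rewrite zE andbT.
  have -> : zeros 0 c = set0 by apply/setP=> x; rewrite zE andbF inE.
  by rewrite cards0.
have b0' : b ^+ (q ^ r) != 0 by rewrite expf_eq0 negb_and b0 orbT.
rewrite zerosE -Dset_frobenius -quadric_quadf.
have -> : q%:Z = #|F|%:Z by rewrite cardF.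
have XX : X%:Z ^+ 2 = (X ^ 2)%N by rewrite -!natz natrX.
case: ifPn => Db; have [->|c0] := eqVneq c 0; rewrite ?oppr0.
- exact: (card_singular_section0 quadfD quadfZ polarZD polar_nondegenerate
            cardL' cardD' Db b0').
- by rewrite XX (card_singular_section_neq0 quadfD quadfZ polarZD
       polar_nondegenerate cardL' Db b0') // oppr_eq0.
- by rewrite XX (card_nonsingular_section0 quadfD quadfZ polarZD
       polar_nondegenerate cardL' cardD' Db).
- by rewrite (card_nonsingular_section_neq0 quadfD quadfZ polarZD
       polar_nondegenerate cardL' cardD' Db) ?oppr_eq0.
Qed.

End TraceForm.

(** * Linear codes and their duals *)

Section LinearCodes.
Variables (F : finFieldType) (n : nat).
Implicit Types (C : {set 'rV[F]_n}) (v : 'rV[F]_n).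

Lemma wt0 : wt (0 : 'rV[F]_n) = 0%N.
Proof. by apply/eqP; rewrite cards_eq0; apply/eqP/setP => i; rewrite !inE mxE eqxx. Qed.

Lemma mulmx_tr_eq0 v (c : 'rV[F]_n) :
  (v *m c^T == 0) = (\sum_i v 0 i * c 0 i == 0).
Proof.
apply/eqP/eqP => [/matrixP/(_ 0 0)|vc]; last (apply/matrixP => i j; rewrite !ord1); rewrite !mxE.
  by move=> vc; rewrite -[RHS]vc; apply: eq_bigr => i _; rewrite !mxE.
by rewrite -[RHS]vc; apply: eq_bigr => k _; rewrite !mxE.
Qed.

Lemma dim_rV k : dim 'rV[F]_k = k.
Proof. by rewrite dim_matrix; apply: mul1n. Qed.

Lemma is_linearP C : 0 \in C ->
  (forall a u v, u \in C -> v \in C -> a *: u + v \in C) -> is_linear C.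
Proof.
move=> C0 Ccl v /(coord_span (X := in_tuple (enum C))) ->.
elim/big_ind: _ => // [u w Cu Cw|i _]; first by rewrite -[u]scale1r Ccl.
rewrite -[_ *: _]addr0 Ccl // -mem_enum.
by apply: mem_nth; rewrite [X in (_ < X)%N](size_tuple (in_tuple _)).
Qed.

Lemma mem_code_span C v : is_linear C -> (v \in <<enum C>>%VS) = (v \in C).
Proof.
by move=> Clin; apply/idP/idP => [/Clin//|Cv]; rewrite memv_span // mem_enum.
Qed.

Lemma card_code C : is_linear C -> #|C| = (#|F| ^ code_dim C)%N.
Proof.
move=> Clin; rewrite /code_dim -card_vspace.
by apply: eq_card => v; rewrite mem_code_span.
Qed.

Lemma code_dim_le C : (code_dim C <= n)%N.
Proof.
by rewrite (leq_trans (dimvS (subvf _))) // dimvf dim_rV.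
Qed.

Lemma mem_dual C v : reflect (forall c, c \in C -> v *m c^T = 0) (v \in dual C).
Proof. by rewrite inE; apply: (iffP forall_inP) => H c /H/eqP. Qed.

Lemma dual_linear C : is_linear (dual C).
Proof.
apply: is_linearP => [|a u v /mem_dual Du /mem_dual Dv]; apply/mem_dual => c Cc.
  by rewrite mul0mx.
by rewrite mulmxDl -scalemxAl Du // Dv // scaler0 addr0.
Qed.

(** The dual is the kernel of [v *m M^T], where the rows of [M] form a basis of the span of [C].
    Independence of the rows makes this map onto, and rank-nullity concludes. *)
Lemma code_dim_dual C : (code_dim (dual C) = n - code_dim C)%N.
Proof.
set W := <<enum C>>%VS; pose M := \matrix_(i < \dim W) (vbasis W)`_i.
have Mfree : row_free M.
  rewrite -kermx_eq0; apply/eqP/row_matrixP => i; rewrite row0.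
  set u := row i _; have uM : u *m M = 0 by apply/sub_kermxP/row_sub.
  have := basis_free (vbasisP W) => /freeP/(_ (fun j => u 0 j)) u0.
  apply/rowP => j; rewrite u0 ?[RHS]mxE // -[RHS]uM mulmx_sum_row.
  by apply: eq_bigr => k _; rewrite rowK.
pose f : 'Hom('rV[F]_n, 'rV[F]_(\dim W)) := linfun (mulmxr M^T).
have dualE : <<enum (dual C)>>%VS = lker f.
  apply/vspaceP => v; rewrite mem_code_span; last exact: dual_linear.
  rewrite memv_ker lfunE /=; apply/mem_dual/eqP => [Dv|vM c Cc].
    have Wv w : w \in W -> v *m w^T = 0.
      move/(coord_span (X := in_tuple (enum C))) => ->.
      rewrite linear_sum mulmx_sumr big1 // => j _.
      rewrite linearZ -scalemxAr Dv ?scaler0 // -mem_enum.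
      by apply: mem_nth; rewrite [X in (_ < X)%N](size_tuple (in_tuple _)).
    apply/rowP => j; have := Wv (vbasis W)`_j.
    rewrite vbasis_mem ?mem_nth ?size_tuple // => /(_ isT)/rowP/(_ 0).
    rewrite !mxE => vj; rewrite -[RHS]vj; apply: eq_bigr => k _.
    by rewrite !mxE.
  have /coord_vbasis -> : c \in W by rewrite memv_span // mem_enum.
  rewrite linear_sum mulmx_sumr big1 // => j _.
  have -> : (vbasis W)`_j = row j M by rewrite rowK.
  by rewrite linearZ -scalemxAr /= tr_row colE mulmxA vM mul0mx scaler0.
rewrite /code_dim dualE -/W; have := limg_ker_dim f fullv.
have /eqP -> : (f @: fullv == fullv)%VS.
  (* A right inverse [N] of [M] provides the preimage [u *m N^T] of [u]. *)
  rewrite eqEsubv subvf; apply/subvP => u _.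
  have [N MN] := row_freeP Mfree.
  have -> : u = f (u *m N^T) by rewrite lfunE /= -mulmxA -trmx_mul MN trmx1 mulmx1.
  exact/memv_img/memvf.
by rewrite capfv !dimvf !dim_rV => dimE; rewrite -[X in (X - _)%N]dimE addnK.
Qed.

End LinearCodes.

(** * Weights and parameters of the trace code *)

Section TraceCode.
Variables (F L : finFieldType) (iota : {rmorphism F -> L}) (q r : nat).
Hypothesis qL : [pchar L].-nat q.
Hypothesis q_gt1 : (1 < q)%N.
Hypothesis r_gt1 : (1 < r)%N.
Hypothesis cardF : #|F| = q.
Hypothesis cardL : #|L| = (q ^ (2 * r))%N.

Local Notation D := (Dset L q r).
Local Notation X := (q ^ (r - 1))%N.
Local Notation C := (codeD iota q (2 * r) r).
Local Notation tr := (trace iota q r).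

Let q_gt0 : (0 < q)%N. Proof. exact: ltnW. Qed.
Let r_gt0 : (0 < r)%N. Proof. exact: ltnW. Qed.

Let X_ge_q : (q <= X)%N.
Proof. by rewrite -{1}(expn1 q) leq_exp2l // subn_gt0. Qed.

Let D0 : 0 \in D. Proof. by rewrite inE expr0n trq0. Qed.

Let cardDZ : #|D|%:Z = q%:Z * X%:Z ^+ 2 - (q%:Z - 1) * X%:Z.
Proof. exact: (card_Dset iota qL q_gt1 r_gt0 cardF cardL). Qed.

Let cardD1 : #|D :\ 0|%:Z = #|D|%:Z - 1.
Proof. by rewrite (cardsD1 0 D) D0 PoszD addrC addKr. Qed.

Definition eval_word (g : L -> F) : 'rV[F]_#|D| := \row_i g (enum_val i).

Lemma wt_eval_word g : wt (eval_word g) = #|[set x in D | g x != 0]|.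
Proof.
rewrite /wt -(card_imset _ (@enum_val_inj _ D)); apply: eq_card => x.
apply/imsetP/idP => [[i + ->]|]; rewrite !inE ?mxE.
  by move=> ->; rewrite andbT; have := enum_valP i; rewrite inE.
case/andP=> Dx gx; have Dx' : x \in D by rewrite inE.
by exists (enum_rank_in Dx' x); rewrite ?inE ?mxE enum_rankK_in.
Qed.

Definition trace_word (u : L * F) := eval_word (fun x => tr (u.1 * x) + u.2).

Lemma trace_wordZD a u v : trace_word (iota a * u.1 + v.1, a * u.2 + v.2)
  = a *: trace_word u + trace_word v.
Proof.
apply/rowP=> i; rewrite !mxE /= mulrDl -mulrA.
by rewrite (traceZD iota qL q_gt1 cardF cardL); ring.
Qed.

Lemma codeDE : C = [set trace_word u | u : L * F].
Proof.
apply/setP=> w; rewrite inE; apply/existsP/imsetP => [[b /existsP[c /forallP wE]]|].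
  exists (b, c) => //; apply/rowP=> i; apply: (fmorph_inj iota).
  by rewrite (eqP (wE i)) mxE rmorphD (iota_trace iota qL q_gt1 cardF cardL).
case=> -[b c] _ ->; exists b; apply/existsP; exists c; apply/forallP => i.
by rewrite mxE rmorphD (iota_trace iota qL q_gt1 cardF cardL).
Qed.

Lemma wt_trace_word b c : (wt (trace_word (b, c)))%:Z =
  if b == 0 then (if c == 0 then 0 else #|D|%:Z)
  else if b \in D
  then (if c == 0 then X%:Z ^+ 2 * (q%:Z - 1) else #|D|%:Z - X%:Z ^+ 2)
  else (if c == 0 then #|D|%:Z - X%:Z ^+ 2 else #|D|%:Z - X%:Z ^+ 2 + X%:Z).
Proof.
have : (wt (trace_word (b, c)) + #|zeros iota q r b c| = #|D|)%N.
  rewrite wt_eval_word addnC -[RHS](cardsID (zeros iota q r b c)); congr (_ + _)%N.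
    by apply: eq_card => x; rewrite !inE andbA andbb.
  by apply: eq_card => x; rewrite !inE; case: (_ == 0) => //=; rewrite andbT.
move/(congr1 Posz); rewrite PoszD (card_zeros iota qL q_gt1 r_gt0 cardF cardL).
move/(canRL (addrK _)) ->; case: ifP => _; first by case: ifP => _; ring.
by case: ifP => _; case: ifP => _; rewrite cardDZ; ring.
Qed.

Let d := (X * (q ^ r - X - q + 1))%N.

(** The subtractions in [d] do not truncate, because [2 <= q <= X]; the second inequality uses
    [1 < r]. *)
Let dE : d%:Z = #|D|%:Z - X%:Z ^+ 2.
Proof.
rewrite cardDZ /d; have -> : (q ^ r = q * X)%N by rewrite -expnS subn1 prednK.
move: X_ge_q q_gt1; move: X => x; nia.
Qed.

Let d_gt0 : (0 < d)%N.
Proof.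
rewrite -ltz_nat dE cardDZ; move: X_ge_q q_gt1; move: X => x; nia.
Qed.

Lemma wt_trace_word_ge u : u != 0 -> (d <= wt (trace_word u))%N.
Proof.
case: u => b c u0; rewrite -lez_nat dE wt_trace_word.
have [b0|b0] := eqVneq b 0; have [c0|c0] := eqVneq c 0.
- by rewrite b0 c0 eqxx in u0.
- by nia.
(* Here [d] is [(q - 1) * (X ^ 2 - X)], which lies below the weight [(q - 1) * X ^ 2] of a singular
   [b] and equals that of a nonsingular one. *)
- by rewrite cardDZ; case: ifP => _; move: X_ge_q q_gt1; move: X => x; nia.
- by case: ifP => _; lia.
Qed.

Lemma trace_word0 : trace_word 0 = 0.
Proof.
have := trace_wordZD 1 0 0; rewrite rmorph1 !mulr0 !addr0 scale1r.
by move/eqP; rewrite -subr_eq subrr => /eqP <-.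
Qed.

(** A nonzero pair gives weight at least [d > 0]. This is what makes the parametrization injective
    and fixes the dimension. *)
Lemma trace_word_eq0 u : (trace_word u == 0) = (u == 0).
Proof.
apply/eqP/eqP => [u0|->]; last exact: trace_word0.
apply: contraTeq d_gt0 => /wt_trace_word_ge; rewrite u0 wt0.
by rewrite leqn0 => /eqP ->.
Qed.

Lemma trace_word_inj : injective trace_word.
Proof.
move=> u v uv; apply/eqP; rewrite -subr_eq0 -trace_word_eq0.
have -> : u - v = (iota (-1) * v.1 + u.1, -1 * v.2 + u.2).
  by case: u {uv} v => [b c] [b' c']; rewrite rmorphN1 !mulN1r ![- _ + _]addrC.
by rewrite trace_wordZD uv scaleN1r addNr.
Qed.

Lemma trace_code_linear : is_linear C.
Proof.
rewrite codeDE; apply: is_linearP => [|a _ _ /imsetP[u _ ->] /imsetP[v _ ->]].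
  by apply/imsetP; exists 0; rewrite ?trace_word0.
by rewrite -trace_wordZD; apply: imset_f.
Qed.

Lemma trace_code_dim : code_dim C = (2 * r).+1.
Proof.
have := card_code trace_code_linear; rewrite {1}codeDE card_imset; last exact: trace_word_inj.
rewrite card_prod cardL cardF -expnSr => /eqP.
by rewrite eqn_exp2l // => /eqP.
Qed.

Let D_nonzero : exists2 x, x \in D & x != 0.
Proof.
have /card_gt0P[x /setD1P[x0 Dx]] : (0 < #|D :\ 0%R|)%N; last by exists x.
rewrite -ltz_nat cardD1 cardDZ; move: X_ge_q q_gt1; move: X => x; nia.
Qed.

Lemma trace_code_params : code_params C (2 * r).+1 d.
Proof.
split; [exact: trace_code_linear | exact: trace_code_dim | split].
  (* A nonzero singular [x] with a nonzero constant attains the minimum weight. *)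
  have [x Dx x0] := D_nonzero; exists (trace_word (x, 1)).
    by rewrite codeDE imset_f.
  rewrite trace_word_eq0 xpair_eqE negb_and x0 /=.
  by rewrite -eqz_nat wt_trace_word (negbTE x0) Dx oner_eq0 dE.
move=> _ /[1!codeDE]/imsetP[u _ ->]; rewrite trace_word_eq0.
exact: wt_trace_word_ge.
Qed.

(** The pairs [(b, c)] are split by [b] zero, singular or nonsingular, and then by whether [c] is
    zero. Indicators of each weight keep the formula valid when several weights coincide. *)
Lemma trace_code_weights (w : int) : #|[set c in C | (wt c)%:Z == w]|%:Z =
  (0 == w)%:R + (q%:Z - 1) * (#|D|%:Z == w)%:R
  + (#|D|%:Z - 1) * ((X%:Z ^+ 2 * (q%:Z - 1) == w)%:R
                     + (q%:Z - 1) * (#|D|%:Z - X%:Z ^+ 2 == w)%:R)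
  + (#|L|%:Z - #|D|%:Z) * ((#|D|%:Z - X%:Z ^+ 2 == w)%:R
                     + (q%:Z - 1) * (#|D|%:Z - X%:Z ^+ 2 + X%:Z == w)%:R).
Proof.
have -> : [set c in C | (wt c)%:Z == w]
    = trace_word @: [set u | (wt (trace_word u))%:Z == w].
  apply/setP => c; rewrite codeDE inE.
  apply/andP/imsetP => [[/imsetP[u _ ->] uw]|[u + ->]]; first by exists u; rewrite ?inE.
  by rewrite inE => ->; rewrite imset_f.
rewrite card_imset; last exact: trace_word_inj.
rewrite card_predT_sum (eq_bigr (fun u => ((wt (trace_word (u.1, u.2)))%:Z == w)%:R)); last by case.
rewrite -(pair_bigA _ (fun b c => ((wt (trace_word (b, c)))%:Z == w)%:R)) /=.
have sumF (f : F -> int) k0 k : f 0 = k0 -> (forall c, c != 0 -> f c = k) ->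
    \sum_c f c = k0 + (q%:Z - 1) * k.
  move=> f0 fk; rewrite (bigD1 0) //= f0 (eq_bigr (fun=> k)) //.
  rewrite sumr_const cardC1 cardF -[k *+ _]mulr_natl natz.
  by rewrite -[in q%:Z](prednK q_gt0); lia.
rewrite (bigID (mem D)) /= (big_setD1 0) //=; congr (_ + _ + _).
- by apply: sumF => [|c c0]; rewrite wt_trace_word eqxx ?eqxx ?(negbTE c0).
- rewrite -cardD1 -[#|_ :\ 0|%:Z]natz mulr_natl -sumr_const; apply: eq_bigr => b.
  case/setD1P=> b0 Db; apply: sumF => [|c c0].
    by rewrite wt_trace_word (negbTE b0) Db eqxx.
  by rewrite wt_trace_word (negbTE b0) Db (negbTE c0).
- have -> : #|L|%:Z - #|D|%:Z = #|~: D|%:R.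
    by rewrite natz -(cardsC D) PoszD addrC addKr.
  rewrite mulr_natl -sumr_const; apply: eq_big => [b|b Db]; first by rewrite [RHS]in_setC.
  have b0 : b == 0 = false by apply: contraNF Db => /eqP ->.
  apply: sumF => [|c c0]; first by rewrite wt_trace_word b0 (negbTE Db) eqxx.
  by rewrite wt_trace_word b0 (negbTE Db) (negbTE c0).
Qed.

(** * The dual code and its minimum distance *)

(** The pairing of [v] with the word of [(b, c)] is a trace of [b] times the second sum, plus [c]
    times the first. Taking [b = 0] kills the first sum and nondegeneracy of the trace the
    second. *)
Lemma mem_dual_trace_code (v : 'rV[F]_#|D|) : reflect
  (\sum_i v 0 i = 0 /\ \sum_i iota (v 0 i) * enum_val i = 0) (v \in dual C).
Proof.
have tr0 : tr 0 = 0.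
  by have := traceZ iota qL q_gt1 cardF cardL 0 0; rewrite mulr0 mul0r.
have vC b c : \sum_i v 0 i * trace_word (b, c) 0 i
    = tr (b * \sum_i iota (v 0 i) * enum_val i) + (\sum_i v 0 i) * c.
  rewrite mulr_sumr mulr_suml.
  have -> : tr (\sum_i b * (iota (v 0 i) * enum_val i))
      = \sum_i tr (b * (iota (v 0 i) * enum_val i)).
    apply: (fmorph_inj iota); rewrite (iota_trace iota qL q_gt1 cardF cardL) rmorph_sum.
    elim/big_rec2: _ => [|i x y _ <-]; first by rewrite trq0.
    by rewrite trqD // (iota_trace iota qL q_gt1 cardF cardL).
  rewrite -big_split; apply: eq_bigr => i _ /=.
  by rewrite mxE mulrDr mulrCA (traceZ iota qL q_gt1 cardF cardL).
apply: (iffP (mem_dual _ _)) => [Dv|[v1 v2] _ /[1!codeDE]/imsetP[[b c] _ ->]].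
  have {}Dv b c : tr (b * \sum_i iota (v 0 i) * enum_val i) + (\sum_i v 0 i) * c = 0.
    by apply/eqP; rewrite -vC -mulmx_tr_eq0 Dv // codeDE imset_f.
  have v1 : \sum_i v 0 i = 0 by have := Dv 0 1; rewrite mul0r tr0 add0r mulr1.
  split=> //; apply/eqP; apply: contraT => s0.
  have [b] := trace_nondegenerate iota qL q_gt1 r_gt0 cardF cardL s0.
  by have := Dv b 0; rewrite mulr0 addr0 mulrC => ->; rewrite eqxx.
by apply/eqP; rewrite mulmx_tr_eq0 vC v1 v2 mulr0 mul0r addr0 tr0.
Qed.

Lemma dual_eval_word (g : L -> F) (T : {set L}) : T \subset D ->
    (forall x, (g x != 0) = (x \in T)) ->
    \sum_(x in T) g x = 0 -> \sum_(x in T) iota (g x) * x = 0 ->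
  eval_word g \in dual C /\ wt (eval_word g) = #|T|.
Proof.
move=> TD gT s1 s2; have g0 x : x \notin T -> g x = 0 by rewrite -gT negbK => /eqP.
split; last first.
  rewrite wt_eval_word; apply: eq_card => x; rewrite in_set gT.
  by case Tx: (x \in T); rewrite ?andbF // (subsetP TD).
apply/mem_dual_trace_code; split.
  under eq_bigr do rewrite mxE.
  rewrite -(big_enum_val g) (big_setID T) /= (setIidPr TD) s1 add0r big1 // => x.
  by case/setDP=> _ /g0.
under eq_bigr do rewrite mxE.
rewrite -(big_enum_val (fun x => iota (g x) * x)) (big_setID T) /= (setIidPr TD) s2.
by rewrite add0r big1 // => x /setDP[_ /g0 ->]; rewrite rmorph0 mul0r.
Qed.

(** A support of size one contradicts the zero coordinate sum. With a support of size two the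
    coefficients are opposite, which would identify two distinct points. *)
Lemma wt_dual_ge3 v : v \in dual C -> v != 0 -> (2 < wt v)%N.
Proof.
move/mem_dual_trace_code=> [s1 s2] v0; rewrite /wt; set A := [set i | _].
have sA (R : zmodType) (f : 'I_#|D| -> R) : (forall i, v 0 i = 0 -> f i = 0) ->
    \sum_i f i = \sum_(i in A) f i.
  move=> f0; rewrite [RHS]big_mkcond; apply: eq_bigr => i _ /=.
  by rewrite inE; case: eqP => //= /f0.
rewrite sA // in s1; rewrite sA in s2; last by move=> i ->; rewrite rmorph0 mul0r.
have vA i : i \in A -> v 0 i != 0 by rewrite inE.
rewrite ltnNge; apply/negP; rewrite leq_eqVlt ltnS leq_eqVlt ltnS leqn0.
case/or3P => [/cards2P[i [j [ij AE]]]|/cards1P[i AE]|].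
- rewrite AE !big_setU1 ?inE //= !big_set1 in s1 s2.
  have vj : v 0 j = - v 0 i by apply/eqP; rewrite -addr_eq0 addrC s1.
  move: s2; rewrite vj rmorphN mulNr -mulrBr => /eqP; rewrite mulf_eq0 fmorph_eq0.
  rewrite (negbTE (vA i _)) ?AE ?inE ?eqxx //= subr_eq0 => /eqP/enum_val_inj/eqP.
  by rewrite (negbTE ij).
- by rewrite AE big_set1 in s1; have := vA i; rewrite AE inE s1 !eqxx => /(_ isT).
- rewrite cards_eq0 => /eqP A0; case/eqP: v0; apply/rowP => i; apply/eqP.
  by rewrite [X in _ == X]mxE; have := in_set0 i; rewrite -A0 inE => /negbFE.
Qed.

Lemma dual_trace_code_dim : code_dim (dual C) = (#|D| - 2 * r - 1)%N.
Proof. by rewrite code_dim_dual trace_code_dim -subnDA addn1. Qed.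

Lemma trace_code_dim_le : ((2 * r).+1 <= #|D|)%N.
Proof. by rewrite -trace_code_dim code_dim_le. Qed.

(* Three points of [D] on a line through the origin. *)
Lemma dual_params_gt2 : (2 < q)%N -> code_params (dual C) (#|D| - 2 * r - 1) 3.
Proof.
move=> q_gt2; split; [exact: dual_linear | exact: dual_trace_code_dim | split]; last first.
  exact: wt_dual_ge3.
have [x Dx x0] := D_nonzero.
have /subsetPn[s _ /[!inE]/norP[s0 s1]] : ~~ ([set: F] \subset [set 0; 1]).
  apply: contraL q_gt2 => /subset_leq_card; rewrite cardsT cardF cards2 -leqNgt.
  by move/leq_trans; apply; case: eqP.
(* The coefficients [s - 1], [-s] and [1] at [0], [x] and [s x] have sum zero, and so has the
   weighted sum of the points. *)
pose g y := if y == 0 then s - 1 else if y == x then - s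
            else if y == iota s * x then 1 else 0.
have sx0 : iota s * x != 0 by rewrite mulf_neq0 ?fmorph_eq0.
have sxx : iota s * x != x.
  by rewrite -subr_eq0 -[X in _ - X]mul1r -mulrBl mulf_neq0 // -(rmorph1 iota)
     -rmorphB fmorph_eq0 subr_eq0.
have g0 : g 0 = s - 1 by rewrite /g eqxx.
have gx : g x = - s by rewrite /g (negbTE x0) eqxx.
have gsx : g (iota s * x) = 1 by rewrite /g (negbTE sx0) (negbTE sxx) eqxx.
have notin1 : x \notin [set iota s * x] by rewrite inE eq_sym.
have notin0 : 0 \notin x |: [set iota s * x].
  by rewrite !inE ![0 == _]eq_sym negb_or x0.
have [] := @dual_eval_word g (0 |: (x |: [set iota s * x])).
- apply/subsetP => y; rewrite !in_setU1 in_set1.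
  case/or3P => /eqP -> //; rewrite -(quadric_quadf iota qL q_gt1 cardF cardL).
  apply: (quadricZ (quadfZ iota qL q_gt1 cardF cardL)).
  by rewrite (quadric_quadf iota qL q_gt1 cardF cardL).
- move=> y; rewrite !inE /g; case: ifP => _; first by rewrite subr_eq0.
  case: ifP => _; first by rewrite oppr_eq0.
  by case: ifP => _; rewrite ?oner_eq0 ?eqxx.
- rewrite !big_setU1 // big_set1 g0 gx gsx /=; ring.
- rewrite !big_setU1 // big_set1 g0 gx gsx /=.
  by rewrite rmorphN rmorph1; ring.
rewrite !cardsU1 cards1 notin1 notin0 => Cg wg.
exists (eval_word g); rewrite // wg eqxx andbT.
by apply/eqP => w0; rewrite w0 wt0 in wg.
Qed.

Let nonzero_eq1 : q = 2%N -> forall s : F, s != 0 -> s = 1.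
Proof.
move=> q2 s s0; apply: (mulfI s0); rewrite mulr1.
by have := expf_card s; rewrite cardF q2.
Qed.

(** Over the field of order 2 the coordinate sum is the weight modulo 2, so weight 3 is excluded by
    parity. *)
Lemma wt_dual_ge4 v : q = 2%N -> v \in dual C -> v != 0 -> (3 < wt v)%N.
Proof.
move=> q2 Cv v0; rewrite ltn_neqAle wt_dual_ge3 // andbT.
apply/eqP => wv; case/mem_dual_trace_code: Cv => s1 _.
have : \sum_i v 0 i = (wt v)%:R.
  rewrite /wt -[#|[set i | v 0 i != 0]|]sum1_card natr_sum big_mkcond [RHS]big_mkcond /=.
  apply: eq_bigr => i _; rewrite inE; have [->//|vi] := eqVneq (v 0 i) 0.
  by rewrite (nonzero_eq1 q2 vi).
have N1 : -1 = 1 :> F by apply: (nonzero_eq1 q2); rewrite oppr_eq0 oner_eq0.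
rewrite -wv s1 => /eqP; rewrite !mulrS mulr0n addr0 -{2}N1 addNr addr0 eq_sym.
by rewrite oner_eq0.
Qed.

(* Four points of [D] forming a totally singular plane over the field of order 2. *)
Lemma dual_params_eq2 : q = 2%N -> (2 < r)%N ->
  code_params (dual C) (#|D| - 2 * r - 1) 4.
Proof.
move=> q2 r_gt2; split; [exact: dual_linear | exact: dual_trace_code_dim | split]; last first.
  by move=> v; apply: wt_dual_ge4.
(* With this conjugate, [tr (b * y)] is the polar form of [x] and [y]. *)
have [x Dx x0] := D_nonzero; pose b := x ^+ (q ^ r).
have b0 : b != 0 by rewrite expf_eq0 negb_and x0 orbT.
have Db : b \in D by rewrite (Dset_frobenius cardL).
have X4 : (4 <= X)%N.
  by rewrite q2 -[4%N]/(2 ^ 2)%N leq_exp2l //; lia.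
(* The [X ^ 2 - X] singular vectors orthogonal to [x] outnumber [0] and [x] since [4 <= X]; for
   [r = 2] there would be exactly two. *)
have : ~~ (zeros iota q r b 0 \subset [set 0; x]).
  apply/negP => /subset_leq_card; rewrite cards2 -lez_nat.
  rewrite (card_zeros iota qL q_gt1 r_gt0 cardF cardL) (negbTE b0) Db eqxx.
  by rewrite {2}q2; case: eqP => _; move: X4; move: X => k; nia.
case/subsetPn=> y; rewrite in_set addr0 => /andP[Dy /eqP By] /[!inE]/norP[y0 yx].
have Dxy : x + y \in D.
  move: Dx Dy; rewrite -!(quadric_quadf iota qL q_gt1 cardF cardL) !in_set.
  move=> /eqP Qx /eqP Qy; rewrite (quadfD iota qL q_gt1 cardF cardL) Qx Qy.
  by rewrite /polar By !addr0.
have N1 : -1 = 1 :> F by apply: (nonzero_eq1 q2); rewrite oppr_eq0 oner_eq0.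
have F2 : 1 + 1 = 0 :> F by rewrite -{1}N1 addNr.
have NL (z : L) : z + z = 0.
  by apply/eqP; rewrite addr_eq0 -[X in - X]mul1r -mulNr -(rmorph1 iota) -rmorphN N1 rmorph1 mul1r.
(* All four coefficients are 1, and [0 + x + y + (x + y)] vanishes in characteristic 2. *)
pose T := 0 |: (x |: (y |: [set x + y])); pose g z : F := (z \in T)%:R.
have n1 : y \notin [set x + y] by rewrite inE -{1}[y]add0r (inj_eq (addIr y)) eq_sym.
have n2 : x \notin y |: [set x + y].
  by rewrite !inE negb_or eq_sym yx -{1}[x]addr0 (inj_eq (addrI x)) eq_sym.
have n3 : 0 \notin x |: (y |: [set x + y]).
  rewrite !inE !negb_or ![0 == _]eq_sym x0 y0 /= addr_eq0.
  by apply: contra yx => /eqP ->; rewrite -addr_eq0 NL.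
have gE z : z \in T -> g z = 1 by rewrite /g => ->.
have [] := @dual_eval_word g T.
- by apply/subsetP => z; rewrite !in_setU1 in_set1; case/or4P => /eqP ->.
- by move=> z; rewrite /g; case: (z \in T); rewrite ?oner_eq0 ?eqxx.
- rewrite (eq_bigr _ gE) !big_setU1 // big_set1 /=.
  by rewrite F2 addr0 F2.
- rewrite (eq_bigr (fun z => z)) => [|z /gE ->]; last by rewrite rmorph1 mul1r.
  by rewrite !big_setU1 // big_set1 /= add0r addrA NL.
rewrite !cardsU1 cards1 n1 n2 n3 => Cg wg.
by exists (eval_word g); rewrite // wg eqxx andbT; apply/eqP => g0; rewrite g0 wt0 in wg.
Qed.

End TraceCode.

(** * Sphere-packing estimates *)

(** Distance 5 means radius 2. Cancelling [q ^ (n - m - 1)] leaves the ball size against [q ^ m.+1],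
    and doubling clears the denominator of ['C(n, 2)]. *)
Lemma spb_excludes5 (q n m : nat) : (0 < q)%N -> (m < n)%N ->
  (2 * q ^ m.+1 < 2 + 2 * (n * (q - 1)) + n * n.-1 * (q - 1) ^ 2)%N ->
  spb_excludes q n (n - m - 1) 5.
Proof.
move=> q_gt0 mn; rewrite /spb_excludes !big_ord_recr big_ord0 /=.
have -> : (q ^ n = q ^ (n - m - 1) * q ^ m.+1)%N by rewrite -expnD; congr (_ ^ _)%N; lia.
have := mul_bin_diag n 1; rewrite bin1 => -> lt_q.
rewrite ltn_pmul2l ?expn_gt0 ?q_gt0 // -(ltn_pmul2l (isT : 0 < 2)%N).
by move: lt_q; rewrite bin0 bin1 expn0 expn1 !mulnDr mulnA; lia.
Qed.

(** The quadratic term suffices: [n] is at least [2/3] of [q * x ^ 2], [q - 1] at least [2/3] of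
    [q], and [n - 1 >= 17], while [17 * 8 / 27 > 2]. *)
Lemma sphere_bound_gt2 (q x n : nat) : (2 < q)%N -> (q <= x)%N ->
  n = (x * (q * x - q + 1))%N ->
  (2 * (q ^ 3 * x ^ 2) < 2 + 2 * (n * (q - 1)) + n * n.-1 * (q - 1) ^ 2)%N.
Proof.
move=> q_gt2 qx nE; have x_gt2 : (2 < x)%N by apply: leq_trans qx.
have qxx : (3 * (q * x) <= q * x * x)%N by rewrite mulnC leq_mul2l x_gt2 orbT.
have n_ge : (2 * q * x ^ 2 <= 3 * n)%N.
  have : (n + q * x = q * x * x + x)%N.
    have qx_ge : (q <= q * x)%N by rewrite leq_pmulr //; lia.
    by rewrite nE mulnDr mulnBr muln1; have := leq_mul (leqnn x) qx_ge; lia.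
  by rewrite -mulnn; lia.
have n_gt : (17 <= n.-1)%N.
  have := leq_mul q_gt2 (leq_mul x_gt2 x_gt2); move: n_ge; rewrite -mulnn; lia.
have a_ge : ((2 * q) ^ 2 <= (3 * (q - 1)) ^ 2)%N by rewrite leq_exp2r //; lia.
have := leq_mul n_ge a_ge.
have : (n * 17 * (q - 1) ^ 2 <= n * n.-1 * (q - 1) ^ 2)%N.
  by rewrite leq_mul2r leq_mul2l n_gt !orbT.
have : (0 < q ^ 3 * x ^ 2)%N by rewrite muln_gt0 !expn_gt0; lia.
have -> : (2 * q * x ^ 2 * (2 * q) ^ 2 = 8 * (q ^ 3 * x ^ 2))%N.
  by rewrite expnMn [(q ^ 3)%N]expnS; lia.
have -> : (3 * n * (3 * (q - 1)) ^ 2 = 27 * (n * (q - 1) ^ 2))%N by rewrite expnMn; lia.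
move: (q ^ 3 * x ^ 2)%N ((q - 1) ^ 2)%N n.-1 (n * (q - 1))%N => K A k l; lia.
Qed.

(** Here [n = 2 * x ^ 2 - x] is at least [7/4] of [x ^ 2] and [n - 1 >= 20], so the quadratic term
    alone exceeds [16 * x ^ 2]. *)
Lemma sphere_bound_eq2 (x n : nat) : (4 <= x)%N -> n = (x * (2 * x - 2 + 1))%N ->
  (2 * (2 ^ 3 * x ^ 2) < 2 + 2 * (n * (2 - 1)) + n * n.-1 * (2 - 1) ^ 2)%N.
Proof.
move=> x4 nE; have xx : (4 * x <= x ^ 2)%N by rewrite -mulnn leq_mul2r x4 orbT.
have nE' : (n + x = 2 * x ^ 2)%N.
  by rewrite nE mulnDr mulnBr muln1 -mulnn; have := leq_mul (leqnn x) x4; lia.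
have n_gt : (20 <= n.-1)%N by lia.
have := leq_mul (leqnn n) n_gt; lia.
Qed.

Theorem theorem3p6 (p e q r m : nat) (F L : finFieldType)
  (iota : {rmorphism F -> L}) :
  prime p -> (0 < e)%N -> q = (p ^ e)%N -> (2 <= r)%N -> m = (2 * r)%N ->
  #|F| = q -> #|L| = (q ^ m)%N ->
  let C := codeD iota q m r in
  let n := (q ^ (r - 1) * (q ^ r - q + 1))%N in
  let Q := (q%:Z) in
  [/\ #|Dset L q r| = n,
      code_params C m.+1 (q ^ (r - 1) * (q ^ r - q ^ (r - 1) - q + 1))%N,
      has_weight_distribution C
        [:: (0, 1);
            (Q ^+ (r - 1) * (Q ^+ r - Q ^+ (r - 1) - Q + 1),
             Q ^+ (r - 1) * (2 * Q ^+ r.+1 - 2 * Q ^+ r - Q ^+ 2 + 3 * Q - 2) - Q + 1);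
            (Q ^+ (r - 1) * (Q ^+ r - Q ^+ (r - 1) - Q + 2),
             Q ^+ (r - 1) * (Q - 1) * (Q ^+ r.+1 - Q ^+ r + Q - 1));
            (Q ^+ (2 * r - 2) * (Q - 1),
             Q ^+ (r - 1) * (Q ^+ r - Q + 1) - 1);
            (Q ^+ (r - 1) * (Q ^+ r - Q + 1), Q - 1)],
      ((2 < q)%N ->
         code_params (dual C) (n - m - 1) 3 /\ spb_excludes q n (n - m - 1) 5) &
      (q = 2%N -> (2 < r)%N ->
         code_params (dual C) (n - m - 1) 4 /\ spb_excludes q n (n - m - 1) 5)].
Proof.
move=> p_pr e_gt0 qE r_gt1 -> cardF cardL /=.
have q_gt1 : (1 < q)%N by rewrite -cardF finNzRing_gt1.
have r_gt0 : (0 < r)%N by apply: ltnW.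
have qL : [pchar L].-nat q.
  have pL : p \in [pchar L].
    by apply: (card_finPcharP (n := (e * (2 * r))%N)) => //; rewrite cardL qE -expnM.
  rewrite qE pnatX; apply/orP; left; rewrite pnatE //.
have qrE : (q ^ r = q * q ^ (r - 1))%N by rewrite -expnS subn1 prednK.
have q_le : (q <= q ^ (r - 1))%N by rewrite -{1}(expn1 q) leq_exp2l // subn_gt0.
have DZ := card_Dset iota qL q_gt1 r_gt0 cardF cardL.
have cardD : #|Dset L q r| = (q ^ (r - 1) * (q ^ r - q + 1))%N.
  apply/eqP; rewrite -eqz_nat DZ qrE; apply/eqP.
  by move: q_le q_gt1; move: (q ^ (r - 1))%N => x; nia.
have n_gt := trace_code_dim_le iota qL q_gt1 r_gt1 cardF cardL.
have q2rE : (q ^ (2 * r).+1 = q ^ 3 * (q ^ (r - 1)) ^ 2)%N.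
  by rewrite -expnM -expnD; congr (_ ^ _)%N; lia.
rewrite -cardD; split=> //.
- exact: trace_code_params.
- move=> w; rewrite (trace_code_weights iota qL q_gt1 r_gt1 cardF cardL).
  rewrite !big_cons big_nil /=.
  have Qx : q%:Z ^+ (r - 1) = (q ^ (r - 1))%N%:Z by rewrite -!natz natrX.
  have Qr : q%:Z ^+ r = q%:Z * q%:Z ^+ (r - 1) by rewrite -exprS subn1 prednK.
  have Q2r : q%:Z ^+ (2 * r - 2) = (q%:Z ^+ (r - 1)) ^+ 2.
    by rewrite -exprM; congr (_ ^+ _); lia.
  have LZ : #|L|%:Z = q%:Z ^+ 2 * (q ^ (r - 1))%N%:Z ^+ 2.
    rewrite -Qx -exprM -exprD cardL -!natz natrX; congr (_ ^+ _); lia.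
  rewrite [q%:Z ^+ r.+1]exprS Q2r Qr Qx LZ DZ; move: (q ^ (r - 1))%N%:Z q%:Z => x Q.
  have -> : x * (Q * x - x - Q + 1) = Q * x ^+ 2 - (Q - 1) * x - x ^+ 2 by ring.
  have -> : x * (Q * x - x - Q + 2) = Q * x ^+ 2 - (Q - 1) * x - x ^+ 2 + x by ring.
  have -> : x * (Q * x - Q + 1) = Q * x ^+ 2 - (Q - 1) * x by ring.
  (* The five equality tests are treated as independent booleans, so coinciding weights need no
     separate argument. *)
  by do 5! [case: (_ == w)] => /=; ring.
(* Excluding distance 5 leaves room only for 3 or 4, hence at least almost optimal; in the binary
   case below, with distance 4, it means optimal. *)
- move=> q_gt2; split; first exact: dual_params_gt2.
  apply: spb_excludes5 => //; first exact: ltnW.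
  rewrite q2rE; apply: sphere_bound_gt2 => //.
  by rewrite cardD -qrE.
- move=> q2 r_gt2; split; first exact: dual_params_eq2.
  apply: spb_excludes5 => //; first exact: ltnW.
  rewrite q2rE q2; apply: sphere_bound_eq2.
    by rewrite -[4%N]/(2 ^ 2)%N leq_exp2l //; lia.
  by rewrite -q2 cardD -qrE.
Qed.
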